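(* Let $P=\{0,1\}^{\mathbb{N}}$, let $\tau_0,\tau_1:\mathbb{R}^d\to\mathbb{R}^d$ be contractive mappings with attractor $X(\tau)$, and let $\pi:P\to X(\tau)$ be the associated encoding mapping. For every finite Borel measure $\mu$ on $P$, set $\nu:=\mu\circ\pi^{-1}$, i.e. $\nu(E)=\mu(\pi^{-1}(E))$ for Borel subsets $E\subset\mathbb{R}^d$, where $\pi^{-1}(E)=\{\omega\in P:\pi(\omega)\in E\}$. Then $\nu$ is a Borel measure on $\mathbb{R}^d$ supported on $X(\tau)$, with Fourier transform $$\hat\nu(t)=\int_P e^{i2\pi t\cdot\pi(\omega)}\,d\mu(\omega)\qquad\text{for all } t\in\mathbb{R}^d.$$
   Context: $P$ carries the product topology and its Borel $\sigma$-algebra. The attractor $X(\tau)$ is the unique nonempty compact subset $X\subset\mathbb{R}^d$ with $X=\tau_0(X)\cup\tau_1(X)$. The right-shifts on $P$ are $\sigma_b(\omega_1\omega_2\cdots)=(b\,\omega_1\omega_2\cdots)$, $b\in\{0,1\}$. The encoding mapping $\pi:P\to X(\tau)$ is the unique continuous (and onto) map satisfying $\pi\circ\sigma_b=\tau_b\circ\pi$ for $b\in\{0,1\}$; equivalently $\{\pi(\omega)\}=\bigcap_{n\in\mathbb{N}}\tau_{\omega_1}\cdots\tau_{\omega_n}(X(\tau))$. The Fourier transform of a finite measure $\nu$ on $\mathbb{R}^d$ is $\hat\nu(t)=\int e^{i2\pi t\cdot x}\,d\nu(x)$. *)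

(* Defs.v *)
From HB Require Import structures.
From mathcomp Require Import all_boot all_order all_algebra.
From mathcomp Require Import all_classical all_reals all_analysis.
From mathcomp Require Import complex.

Set Implicit Arguments.
Unset Strict Implicit.
Unset Printing Implicit Defensive.
Import Order.TTheory GRing.Theory Num.Theory.
Import numFieldNormedType.Exports.
Local Open Scope classical_set_scope.
Local Open Scope ring_scope.
Local Open Scope complex_scope.

(* The space T with its Borel sigma-algebra; convertible to T. *)
Notation borelType T := (g_sigma_algebraType (@open T)).

Definition dotrv (R : realType) (d : nat) (u v : 'rV[R]_d) : R :=
  \sum_(i < d) u 0 i * v 0 i.

(* The library norm `|x| on 'rV[R]_d is the sup norm, hence a separate
   Euclidean norm. *)
Definition enorm (R : realType) (d : nat) (x : 'rV[R]_d) : R :=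
  Num.sqrt (dotrv x x).

Definition contractive (R : realType) (d : nat)
    (f : 'rV[R]_d -> 'rV[R]_d) : Prop :=
  exists c : R, [/\ 0 <= c, c < 1 &
    forall x y : 'rV[R]_d, enorm (f x - f y) <= c * enorm (x - y)].

(* tau false and tau true are tau_0 and tau_1.  For contractive maps at most
   one set satisfies this predicate, so uniqueness is not repeated here. *)
Definition is_attractor (R : realType) (d : nat)
    (tau : bool -> 'rV[R]_d -> 'rV[R]_d) (X : set 'rV[R]_d) : Prop :=
  [/\ X !=set0, compact X & X = (tau false @` X) `|` (tau true @` X)].

(* The letter omega_n, n >= 1, is stored at index n - 1. *)
Definition right_shift (b : bool) (w : cantor_space) : cantor_space :=
  fun n : nat => if n is m.+1 then w m else b.

(* For contractive maps with attractor X, exactly one map satisfies this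
   predicate, and it is onto X. *)
Definition is_encoding (R : realType) (d : nat)
    (tau : bool -> 'rV[R]_d -> 'rV[R]_d) (X : set 'rV[R]_d)
    (enc : cantor_space -> 'rV[R]_d) : Prop :=
  [/\ set_fun [set: cantor_space] X enc,
      continuous enc &
      forall b : bool, enc \o right_shift b = tau b \o enc].

(* expi x = e^{ix} *)
Definition expi (R : realType) (x : R) : R[i] := cos x +i* sin x.

Definition Cintegrable (disp : measure_display) (T : measurableType disp)
    (R : realType) (mu : {measure set T -> \bar R}) (f : T -> R[i]) : Prop :=
  mu.-integrable [set: T] (fun x => (complex.Re (f x))%:E) /\
  mu.-integrable [set: T] (fun x => (complex.Im (f x))%:E).

Definition Cintegral (disp : measure_display) (T : measurableType disp)
    (R : realType) (mu : {measure set T -> \bar R}) (f : T -> R[i]) : R[i] :=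
  (\int[mu]_x complex.Re (f x)) +i* (\int[mu]_x complex.Im (f x)).

(* The character x |-> e^{i 2 pi t.x}; pi is the real number. *)
Definition fourier_char (R : realType) (d : nat) (t x : 'rV[R]_d) : R[i] :=
  expi (2 * pi * dotrv t x).

Definition fourier_transform (R : realType) (d : nat)
    (nu : {measure set (borelType 'rV[R]_d) -> \bar R})
    (t : 'rV[R]_d) : R[i] :=
  Cintegral nu (fourier_char t).

Definition supported_on (disp : measure_display) (T : measurableType disp)
    (R : realType) (nu : {measure set T -> \bar R}) (X : set T) : Prop :=
  measurable X /\ nu (~` X) = 0%E.

(* Main.v *)
From HB Require Import structures.
Require Import Defs.
From mathcomp Require Import all_boot all_order all_algebra.
From mathcomp Require Import all_classical all_reals all_analysis.
From mathcomp Require Import complex measurable_realfun.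
Import Order.TTheory GRing.Theory Num.Theory.
Import numFieldNormedType.Exports.
Local Open Scope classical_set_scope.
Local Open Scope ring_scope.

(** The encoding map is continuous, hence Borel, so [nu] can be taken to be the pushforward of [mu],
    which is again finite. The attractor is compact in a Hausdorff space, hence closed and Borel;
    the encoding takes its values there, so the complement of [X] has empty preimage and measure
    zero. The Fourier formula is the change of variables of [Rintegral_pushforward], applied to the
    cosine and sine of 2 pi t.x; [Cintegrable_expi] provides integrability, since these are bounded
    and both measures are finite. *)

Lemma continuous_borel_measurable (S T : ptopologicalType) (f : S -> T) :
  continuous f ->
  measurable_fun [set: borelType S] (f : borelType S -> borelType T).
Proof.
move=> /continuousP cf.
have := @measurability _ _ (borelType S) (borelType T) setT f (@open T).
apply => // _ [A oA <-].
by rewrite setTI; apply: sub_sigma_algebra; exact: cf.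
Qed.

(** Here the target carries the native sigma-algebra of [R] rather than [borelType R]; it is
    generated by open intervals, whose preimages are open. *)
Lemma continuous_borel_measurable_real (R : realType) (S : ptopologicalType)
    (f : S -> R) :
  continuous f -> measurable_fun [set: borelType S] f.
Proof.
move=> /continuousP cf; apply: (measurability _ (RGenOpens.measurableE R)).
move=> _ [_ [a [b ->]] <-]; rewrite setTI.
by apply: sub_sigma_algebra; apply/cf/interval_open.
Qed.

(** Coordinates are continuous and separate points, so the property is inherited from [R]. *)
Lemma rV_hausdorff (R : realType) (d : nat) : hausdorff_space 'rV[R]_d.
Proof.
move=> u v uv; apply/rowP => i; apply: (@norm_hausdorff R R) => A B Au Bv.
have [w [Aw Bw]] := uv _ _ (@coord_continuous R 1 d 0 i u _ Au)
                           (@coord_continuous R 1 d 0 i v _ Bv).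
by exists (w 0 i).
Qed.

Lemma continuous_dotrv (R : realType) (d : nat) (t : 'rV[R]_d) :
  continuous (dotrv t).
Proof.
apply: continuous_big => [|i _ x]; first exact: add_continuous.
by apply: continuousM; [exact: cst_continuous|exact: coord_continuous].
Qed.

Lemma Cintegrable_expi (R : realType) (disp : measure_display)
    (T : measurableType disp) (mu : {finite_measure set T -> \bar R})
    (g : T -> R) :
  measurable_fun [set: T] g -> Cintegrable mu (fun x => expi (g x)).
Proof.
move=> mg.
have fin : (mu [set: T] < +oo)%E by rewrite ltey_eq fin_num_measure.
split; apply: (measurable_bounded_integrable measurableT fin).
- exact: measurableT_comp (continuous_measurable_fun (@continuous_cos R)) mg.
(* Boundedness is stated for all [M] near infinity; 1 is a threshold since cosine is at most 1 in
   absolute value. *)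
- exists 1; split; rewrite ?num_real // => M M1 x _ /=.
  exact: le_trans (cos_max _) (ltW M1).
- exact: measurableT_comp (continuous_measurable_fun (@continuous_sin R)) mg.
- exists 1; split; rewrite ?num_real // => M M1 x _ /=.
  exact: le_trans (sin_max _) (ltW M1).
Qed.

Section pushforward.
Context {disp disp' : measure_display} {S : measurableType disp}
  {T : measurableType disp'} {R : realType}.
Variables (mu : {finite_measure set S -> \bar R}) (f : S -> T).
Hypothesis mf : measurable_fun [set: S] f.

(* Unlike [pushforward mu f], this term carries the measurability proof, so that
   the measure structures can be inferred from it. *)
Definition mpushforward (_ : measurable_fun [set: S] f) : set T -> \bar R :=
  pushforward mu f.

HB.instance Definition _ := Measure.copy (mpushforward mf)
  (measure_function_pushforward__canonical__measure_function_Measure mu mf).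

Let mpushforward_finite : fin_num_fun (mpushforward mf).
Proof.
move=> A mA; apply: fin_num_measure.
by rewrite -[X in measurable X]setTI; exact: mf.
Qed.

HB.instance Definition _ :=
  Measure_isFinite.Build _ _ _ (mpushforward mf) mpushforward_finite.

Lemma Rintegral_pushforward (g : T -> R) :
  measurable_fun [set: T] g -> mu.-integrable [set: S] (EFin \o (g \o f)) ->
  \int[mpushforward mf]_y g y = \int[mu]_x g (f x).
Proof.
move=> mg ig; rewrite /Rintegral; congr fine.
by apply: (integral_pushforward mf (D := setT)) => //; exact/measurable_EFinP.
Qed.

End pushforward.

Theorem lemma6p5 (R : realType) (d : nat)
    (tau : bool -> 'rV[R]_d -> 'rV[R]_d) (X : set 'rV[R]_d)
    (enc : cantor_space -> 'rV[R]_d) :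
  (forall b : bool, contractive (tau b)) ->
  is_attractor tau X ->
  is_encoding tau X enc ->
  forall mu : {finite_measure set (borelType cantor_space) -> \bar R},
    (forall E : set (borelType 'rV[R]_d), measurable E ->
       measurable (enc @^-1` E : set (borelType cantor_space))) /\
    exists nu : {finite_measure set (borelType 'rV[R]_d) -> \bar R},
      [/\ forall E : set (borelType 'rV[R]_d), measurable E ->
            nu E = mu (enc @^-1` E),
          supported_on nu X &
          forall t : 'rV[R]_d,
            [/\ Cintegrable nu (fourier_char t),
                Cintegrable mu (fun w => fourier_char t (enc w)) &
                fourier_transform nu t
                = Cintegral mu (fun w => fourier_char t (enc w))]].
Proof.
move=> _ [_ cptX _] [encX cenc _] mu.
have clX : closed X := compact_closed (@rV_hausdorff R d) cptX.
have menc := @continuous_borel_measurable cantor_space 'rV[R]_d enc cenc.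
split.
  by move=> E mE; rewrite -[X in measurable X]setTI; exact: menc.
exists (mpushforward mu (enc : _ -> borelType 'rV[R]_d) menc); split => //.
- split.
    rewrite -[X]setCK; apply: measurableC; apply: sub_sigma_algebra.
    exact: closed_openC.
  (* By conversion the pushforward is [mu] of a preimage, which is empty because [enc] lands in
     [X]. *)
  rewrite -[LHS]/(mu (enc @^-1` (~` X))) (_ : _ @^-1` _ = set0) ?measure0 //.
  by rewrite -subset0 => w; apply; exact: encX.
- move=> t.
  have cdot : continuous (fun x : 'rV[R]_d => 2 * pi * dotrv t x).
    move=> x; apply: (@continuousM R _ (cst (2 * pi)) (dotrv t)).
      exact: cst_continuous.
    exact: continuous_dotrv.
  have mdot : measurable_fun [set: borelType 'rV[R]_d]
                (fun x : 'rV[R]_d => 2 * pi * dotrv t x).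
    exact: continuous_borel_measurable_real cdot.
  have intmu : Cintegrable mu (fun w => fourier_char t (enc w)).
    by apply: Cintegrable_expi; exact: measurableT_comp mdot menc.
  split => //; first exact: Cintegrable_expi.
  (* Real and imaginary parts are transferred separately, each with its component of [intmu]. *)
  by have [? ?] := intmu; congr Complex; apply: Rintegral_pushforward => //;
    [exact: measurableT_comp (continuous_measurable_fun (@continuous_cos R)) mdot
    |exact: measurableT_comp (continuous_measurable_fun (@continuous_sin R)) mdot].
Qed.
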